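(* Let $F$ be a polynomial Euler product of Euler degree $d$. Define $$E(x,F)=\sum_{n\le x}\varphi(n,F)-C(F)x^2,\qquad f(x,F)=-\sum_{n=1}^\infty\frac{\alpha(n)}{n}\left\{\frac{x}{n}\right\},\qquad g(x,F)=\sum_{n=1}^\infty\alpha(n)\left(\left\{\frac{x}{n}\right\}^2+\left[\frac{x}{n}\right]\right).$$ Then for every $x\ge 1$, $$E(x,F)=x f(x,F)+\frac12 g(x,F).$$
   Context: A polynomial Euler product is a function $F(s)$ of a complex variable $s=\sigma+it$ defined for $\sigma>1$ by $F(s)=\prod_p F_p(s)$ with $F_p(s)=\prod_{j=1}^d\left(1-\alpha_j(p)p^{-s}\right)^{-1}$, where $p$ runs over primes and $|\alpha_j(p)|\le 1$ for all $p$ and $1\le j\le d$; $d$ is chosen as small as possible, i.e. there is at least one prime $p_0$ with $\prod_{j=1}^d\alpha_j(p_0)\ne 0$, and $d$ is called the Euler degree of $F$. The associated Euler totient function is $\varphi(n,F)=n\prod_{p\mid n}F_p(1)^{-1}$ for $n\in\mathbb{N}$ (empty product $=1$). Put $\gamma(p)=p\left(1-\frac{1}{F_p(1)}\right)$, $C(F)=\frac12\prod_p\left(1-\frac{\gamma(p)}{p^2}\right)$, and $\alpha(n)=\mu(n)\prod_{p\mid n}\gamma(p)$, where $\mu$ is the Möbius function. For real $x$, $[x]$ is the integer part and $\{x\}=x-[x]$ the fractional part. *)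

(* Defs.v *)
From HB Require Import structures.
From mathcomp Require Import all_boot all_order all_algebra complex.
From mathcomp Require Import all_classical all_reals all_analysis.

Set Implicit Arguments.
Unset Strict Implicit.
Unset Printing Implicit Defensive.

Import Order.TTheory GRing.Theory Num.Theory.
Import numFieldNormedType.Exports.

Local Open Scope classical_set_scope.
Local Open Scope complex_scope.
Local Open Scope ring_scope.

(* The library puts the norm topology on the carrier of any [numFieldType],
   but [R[i]] alone is not recognized as such a carrier; hence the cast. *)
Definition Cplx (R : realType) : numFieldType := R[i].

Definition RtoC (R : realType) (x : R) : Cplx R := x%:C.

(* n ^ s = exp (s log n), for n > 0 *)
Definition cpow (R : realType) (n : nat) (s : Cplx R) : Cplx R :=
  let: sigma +i* t := s in
  (n%:R `^ sigma * cos (t * ln n%:R)) +i* (n%:R `^ sigma * sin (t * ln n%:R)).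

Definition euler_factor (R : realType) (d : nat) (a : nat -> 'I_d -> Cplx R)
    (p : nat) (s : Cplx R) : Cplx R :=
  \prod_(j < d) (1 - a p j * cpow p (- s))^-1.

(* A polynomial Euler product F of Euler degree d, with its local roots
   alpha_j(p); only the values of F on the half-plane Re s > 1 and those of
   [ep_root] at primes are meaningful. *)
Record polyEulerProduct (R : realType) (d : nat) := PolyEulerProduct {
  ep_fun :> Cplx R -> Cplx R;
  ep_root : nat -> 'I_d -> Cplx R;
  ep_root_le1 : forall p j, prime p -> `|ep_root p j| <= 1;
  ep_degree : exists2 p0, prime p0 & \prod_(j < d) ep_root p0 j != 0;
  ep_prod : forall s : Cplx R, 1 < complex.Re s ->
    (fun N : nat => \prod_(0 <= p < N | prime p) euler_factor ep_root p s)
      @ \oo --> ep_fun s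
}.

Definition local_factor (R : realType) (d : nat) (F : polyEulerProduct R d)
    (p : nat) (s : Cplx R) : Cplx R :=
  euler_factor (ep_root F) p s.

Definition moebius (n : nat) : int :=
  if has (fun p => p ^ 2 %| n)%N (primes n) then 0 else (-1) ^+ size (primes n).

Definition frac_part (R : realType) (x : R) : R := x - (Num.floor x)%:~R.

Section EulerTotient.
Variables (R : realType) (d : nat) (F : polyEulerProduct R d).

Definition totientF (n : nat) : Cplx R :=
  n%:R * \prod_(p <- primes n) (local_factor F p 1)^-1.

Definition gammaF (p : nat) : Cplx R := p%:R * (1 - 1 / local_factor F p 1).

Definition constF : Cplx R :=
  1 / 2 * \big[*%R/1]_(0 <= p <oo | prime p) (1 - gammaF p / p%:R ^+ 2).

Definition alphaF (n : nat) : Cplx R :=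
  (moebius n)%:~R * \prod_(p <- primes n) gammaF p.

Definition errorF (x : R) : Cplx R :=
  \sum_(1 <= n < (Num.truncn x).+1) totientF n - constF * RtoC x ^+ 2.

Definition f_F (x : R) : Cplx R :=
  - \big[+%R/0]_(1 <= n <oo) (alphaF n / n%:R * RtoC (frac_part (x / n%:R))).

Definition g_F (x : R) : Cplx R :=
  \big[+%R/0]_(1 <= n <oo)
    (alphaF n * (RtoC (frac_part (x / n%:R)) ^+ 2
                 + (Num.floor (x / n%:R))%:~R)).

End EulerTotient.

(* Main.v *)
Require Import Defs.
From HB Require Import structures.
From mathcomp Require Import all_boot all_order all_algebra complex.
From mathcomp Require Import all_classical all_reals all_analysis.
From mathcomp Require Import ring lra zify.

(** Expanding [n \prod_(p | n) (1 - gamma(p) / p)] over squarefree divisors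
    gives [phi(n, F) = \sum_(m | n) alpha(m) n / m], hence
    [2 \sum_(n <= x) phi(n, F) = \sum_m alpha(m) [x/m] ([x/m] + 1)].
    With [y = x/m] one has
    [[y] ([y] + 1) = y^2 - 2 y {y} + ({y}^2 + [y])], and summing the three
    pieces separately yields [2 C(F) x^2], [2 x f] and [g].
    Splitting is legitimate because for [m > x] all three pieces are constant
    multiples of [alpha(m) / m^2], whose series converges absolutely to
    [\prod_p (1 - gamma(p) / p^2)]: the bound [|gamma(p)| <= 2^d] controls the
    partial products by [exp (2^d \sum 1 / p^2)]. *)

Set Implicit Arguments.
Unset Strict Implicit.
Unset Printing Implicit Defensive.

Import Order.TTheory GRing.Theory Num.Theory.
Import numFieldNormedType.Exports.

Local Open Scope ring_scope.

(** * Squarefree integers and the expansion of products over primes *)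

Definition squarefree (m : nat) : bool :=
  ~~ has (fun p => p ^ 2 %| m)%N (primes m).

Lemma perm_primes_mul_prime (p m : nat) :
  prime p -> (0 < m)%N -> ~~ (p %| m)%N ->
  perm_eq (primes (p * m)) (p :: primes m).
Proof.
move=> pp m0 pm; apply: uniq_perm.
- exact: primes_uniq.
- by rewrite /= primes_uniq mem_primes (negbTE pm) !andbF.
move=> q; rewrite (primesM _ (prime_gt0 pp) m0).
by rewrite primes_prime// !inE.
Qed.

Lemma squarefree_mul_prime (p m : nat) :
  prime p -> (0 < m)%N -> ~~ (p %| m)%N ->
  squarefree (p * m) = squarefree m.
Proof.
move=> pp m0 pm; congr (~~ _).
rewrite (perm_has _ (perm_primes_mul_prime pp m0 pm)) /=.
rewrite expnS expn1 dvdn_pmul2l ?prime_gt0// (negbTE pm) /=.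
apply: eq_in_has => q; rewrite mem_primes => /and3P[pq _ qm].
rewrite Gauss_dvdr//= coprimeXl// prime_coprime// dvdn_prime2//.
by apply: contra pm => /eqP <-.
Qed.

Lemma squarefree_dvd_prime (p m : nat) : prime p -> (0 < m)%N ->
  squarefree (p * m) -> ~~ (p %| m)%N.
Proof.
move=> pp m0; apply: contra => pm; apply/hasP; exists p.
  by rewrite mem_primes pp muln_gt0 prime_gt0// m0 dvdn_mulr.
by rewrite expnS expn1 dvdn_pmul2l ?prime_gt0.
Qed.

(** These numbers index the monomials obtained by expanding [\prod_(p <- s) (1 + c p)]: each prime
    is either skipped or taken once. *)
Fixpoint subset_products (s : seq nat) : seq nat :=
  if s is p :: s' then
    subset_products s' ++ map (muln p) (subset_products s')
  else [:: 1%N].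

(** Induction on [s]: a squarefree [m] either avoids the head [p] or is [p * k] with [k] prime to
    [p], matching the two halves of the list. Positivity is a separate clause because [primes 0] is
    empty, so 0 passes both other tests. *)
Lemma mem_subset_products (s : seq nat) (m : nat) :
  all prime s -> uniq s ->
  (m \in subset_products s) =
  [&& (0 < m)%N, squarefree m & all (mem s) (primes m)].
Proof.
elim: s m => [|p s IH] m.
  move=> _ _; rewrite /= inE; apply/eqP/and3P => [-> //|[m0 _ h]].
  have : primes m == [::] by case: (primes m) h.
  by rewrite primes_eq0; lia.
move=> /= /andP[pp ps] /andP[pns us].
have {}IH k := IH k ps us.
rewrite mem_cat IH; apply/idP/idP.
  case/orP => [/and3P[m0 sm /allP h]|/mapP[k]].
    by rewrite m0 sm; apply/allP => q /h; rewrite !inE orbC => ->.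
  rewrite IH => /and3P[k0 sk /allP h] ->.
  have pk : ~~ (p %| k)%N.
    by apply: contra pns => pk; apply: h; rewrite mem_primes pp k0.
  rewrite muln_gt0 (prime_gt0 pp) k0 squarefree_mul_prime// sk /=.
  rewrite (perm_all _ (perm_primes_mul_prime pp k0 pk)) /= inE eqxx /=.
  by apply/allP => q /h; rewrite !inE orbC => ->.
case/and3P => m0 sm /allP h.
have [pm|pm] := boolP (p %| m)%N; last first.
  apply/orP; left; rewrite m0 sm; apply/allP => q qm.
  have := h _ qm; rewrite !inE => /orP[/eqP qp|//].
  by move: qm; rewrite qp mem_primes (negbTE pm) !andbF.
apply/orP; right; case/dvdnP: pm m0 sm h => k ->.
rewrite mulnC muln_gt0 prime_gt0//= => k0 sm h.
have pk := squarefree_dvd_prime pp k0 sm.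
apply/mapP; exists k => //.
rewrite IH k0 -(squarefree_mul_prime pp k0 pk) sm /=.
apply/allP => q qk; have := h q.
rewrite (perm_mem (perm_primes_mul_prime pp k0 pk)) inE qk orbT => /(_ isT).
rewrite !inE => /orP[/eqP qp|//].
by move: qk; rewrite qp mem_primes (negbTE pk) !andbF.
Qed.

Lemma subset_products_prime_ndvd (s : seq nat) (p m : nat) :
  all prime s -> uniq s -> prime p -> p \notin s ->
  m \in subset_products s -> ~~ (p %| m)%N.
Proof.
move=> ps us pp pns; rewrite mem_subset_products// => /and3P[m0 _ /allP h].
by apply: contra pns => pm; apply: h; rewrite mem_primes pp m0.
Qed.

(** The two halves are disjoint: only the second one contains multiples of the head prime. *)
Lemma subset_products_uniq (s : seq nat) :
  all prime s -> uniq s -> uniq (subset_products s).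
Proof.
elim: s => //= p s IH /andP[pp ps] /andP[pns us].
rewrite cat_uniq (IH ps us) /= map_inj_uniq; last first.
  by move=> i j /eqP; rewrite eqn_pmul2l ?prime_gt0// => /eqP.
rewrite (IH ps us) andbT; apply/hasPn => _ /mapP[k _ ->]; apply/negP => /=.
by move=> /(subset_products_prime_ndvd ps us pp pns); rewrite dvdn_mulr.
Qed.

Lemma prod_sum_subset_products (A : comNzRingType) (b c : nat -> A)
    (s : seq nat) :
  b 1%N = 1 ->
  (forall p m, prime p -> (0 < m)%N -> ~~ (p %| m)%N ->
    b (p * m)%N = c p * b m) ->
  all prime s -> uniq s ->
  \prod_(p <- s) (1 + c p) = \sum_(m <- subset_products s) b m.
Proof.
move=> b1 bM; elim: s => [|p s IH] /=; first by rewrite big_nil big_seq1 b1.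
move=> /andP[pp ps] /andP[pns us].
rewrite big_cons IH// big_cat big_map /= mulrDl mul1r; congr (_ + _).
rewrite mulr_sumr big_seq [RHS]big_seq; apply: eq_bigr => m ms.
rewrite bM//; last exact: subset_products_prime_ndvd ms.
by move: ms; rewrite mem_subset_products// => /and3P[].
Qed.

Lemma subset_products_primes (n : nat) : (0 < n)%N ->
  perm_eq (subset_products (primes n))
          [seq m <- index_iota 1 n.+1 | squarefree m & (m %| n)%N].
Proof.
move=> n0.
have ps : all prime (primes n).
  by apply/allP => p; rewrite mem_primes => /and3P[].
apply: uniq_perm.
- exact: subset_products_uniq (primes_uniq n).
- by rewrite filter_uniq ?iota_uniq.
move=> m; rewrite mem_filter mem_index_iota ltnS.
apply/idP/idP; last first.
  case/andP => /andP[sm mn] /andP[m0 _].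
  rewrite mem_subset_products ?primes_uniq// m0 sm; apply/allP => p.
  by rewrite inE !mem_primes n0 => /and3P[-> _ /dvdn_trans ->].
(* Distinct primes dividing [n] are coprime, so their product still divides [n]. The list is
   generalized to allow induction. *)
have main s : all prime s -> uniq s -> all (fun p => p %| n)%N s ->
    m \in subset_products s -> (m %| n)%N.
  elim: s m => [m|p s IH m] /=; first by rewrite inE => _ _ _ /eqP ->.
  move=> /andP[pp ps'] /andP[pns us] /andP[pn sn].
  rewrite mem_cat => /orP[/IH-> //|/mapP[k ks ->]].
  rewrite Gauss_dvd ?pn ?IH// prime_coprime//.
  exact: subset_products_prime_ndvd ks.
move=> ms; have mn : (m %| n)%N.
  apply: main ms; rewrite ?primes_uniq//.
  by apply/allP => p; rewrite mem_primes => /and3P[].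
move: ms; rewrite mem_subset_products ?primes_uniq// => /and3P[-> -> _].
by rewrite mn dvdn_leq.
Qed.

Lemma big_uniq_sub (I : eqType) (V : zmodType) (f : I -> V) (r r' : seq I) :
  uniq r -> uniq r' -> {subset r <= r'} ->
  \sum_(i <- r') f i = \sum_(i <- r) f i + \sum_(i <- r' | i \notin r) f i.
Proof.
move=> ur ur' rr'; rewrite (bigID (mem r)) /=; congr (_ + _).
rewrite -big_filter; apply: perm_big; apply: uniq_perm => //.
  by rewrite filter_uniq.
by move=> i; rewrite mem_filter; apply: andb_idr => /rr'.
Qed.

Lemma ler_sum_uniq_sub (I : eqType) (A : numDomainType) (f : I -> A)
    (r r' : seq I) :
  uniq r -> uniq r' -> {subset r <= r'} -> (forall i, 0 <= f i) ->
  \sum_(i <- r) f i <= \sum_(i <- r') f i.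
Proof.
move=> ur ur' rr' f0; rewrite (big_uniq_sub _ ur ur' rr') lerDl.
exact: sumr_ge0.
Qed.

(** * Real-valued modulus and convergence of complex sequences *)

Section ComplexNorm.
Variable R : realType.
Implicit Types z w : Cplx R.

(** The norm [|z|] of [Cplx R] is itself a complex number; this version lives in [R], where suprema
    and monotone limits are available. *)
Definition cnorm z : R := Normc.normc z.

Lemma cnormE z : `|z| = RtoC (cnorm z).
Proof. by []. Qed.

Lemma cnorm_ge0 z : 0 <= cnorm z.
Proof. by case: z => a b; exact: sqrtr_ge0. Qed.

Lemma cnormM z w : cnorm (z * w) = cnorm z * cnorm w.
Proof. exact: Normc.normcM. Qed.

Lemma cnorm1 : cnorm 1 = 1.
Proof. exact: Normc.normc1. Qed.

Lemma cnorm0 : cnorm 0 = 0.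
Proof. exact: Normc.normc0. Qed.

Lemma cnormN z : cnorm (- z) = cnorm z.
Proof. exact: (@normcN R z). Qed.

Lemma cnormV z : cnorm z^-1 = (cnorm z)^-1.
Proof. exact: Normc.normcV. Qed.

Lemma cnorm_real (x : R) : cnorm (RtoC x) = `|x|.
Proof. by rewrite /cnorm /= expr0n /= addr0 sqrtr_sqr. Qed.

Lemma cnorm_nat (n : nat) : cnorm n%:R = n%:R.
Proof.
rewrite -[n%:R : Cplx R](rmorph_nat (real_complex R)).
by rewrite (cnorm_real n%:R) ger0_norm.
Qed.

Lemma cnormD_le z w : cnorm (z + w) <= cnorm z + cnorm w.
Proof. exact: (@le_normcD R z w). Qed.

Lemma cnorm_sum_le (I : Type) (r : seq I) (P : pred I) (f : I -> Cplx R) :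
  cnorm (\sum_(i <- r | P i) f i) <= \sum_(i <- r | P i) cnorm (f i).
Proof.
elim/big_rec2: _ => [|i y1 y2 _ h]; first by rewrite cnorm0.
by apply: le_trans (cnormD_le _ _) _; rewrite lerD2l.
Qed.

Lemma Re_le_cnorm z : `|complex.Re z| <= cnorm z.
Proof.
case: z => a b; rewrite -sqrtr_sqr /cnorm /=.
by rewrite ler_sqrt ?lerDl ?addr_ge0 ?sqr_ge0.
Qed.

Lemma Im_le_cnorm z : `|complex.Im z| <= cnorm z.
Proof.
case: z => a b; rewrite -sqrtr_sqr /cnorm /=.
by rewrite ler_sqrt ?lerDr ?addr_ge0 ?sqr_ge0.
Qed.

Lemma cnorm_le_ReIm z : cnorm z <= `|complex.Re z| + `|complex.Im z|.
Proof.
case: z => a b; rewrite /cnorm /=.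
rewrite -(@ler_pXn2r _ 2) ?nnegrE ?sqrtr_ge0 ?addr_ge0//.
rewrite sqr_sqrtr ?addr_ge0 ?sqr_ge0//.
rewrite -(real_normK (num_real a)) -(real_normK (num_real b)).
have := normr_ge0 a; have := normr_ge0 b; nra.
Qed.

Lemma cvg_cnormP (u : nat -> Cplx R) (l : Cplx R) :
  (u @ \oo --> l <-> (fun n => cnorm (l - u n)) @ \oo --> (0 : R))%classic.
Proof.
split=> [/cvgrPdist_lt ul|/cvgrPdist_lt ul]; apply/cvgrPdist_lt => e e0.
  have e0' : 0 < RtoC e by rewrite ltcR.
  near=> n; rewrite sub0r normrN ger0_norm ?cnorm_ge0// -ltcR.
  near: n; exact: ul.
(* A positive element of [Cplx R] has zero imaginary part, so the tolerance [e] is really the real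
   number [a]. *)
case: e e0 => a b; rewrite ltcE /= => /andP[/eqP b0 a0].
rewrite b0; near=> n; rewrite cnormE ltcE /= eqxx /=.
have -> : cnorm (l - u n) = `|0 - cnorm (l - u n)|.
  by rewrite sub0r normrN ger0_norm ?cnorm_ge0.
near: n; exact: ul.
Unshelve. all: by end_near.
Qed.

Lemma cvg_ReIm (u : nat -> Cplx R) (a b : R) :
  ((fun n => complex.Re (u n)) @ \oo --> a)%classic ->
  ((fun n => complex.Im (u n)) @ \oo --> b)%classic ->
  (u @ \oo --> ((a +i* b)%C : Cplx R))%classic.
Proof.
move=> ha hb; apply/cvg_cnormP.
apply: (squeeze_cvgr (f := fun=> 0)
  (h := fun n => `|a - complex.Re (u n)| + `|b - complex.Im (u n)|)).
- near=> n; rewrite cnorm_ge0 /=.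
  have := cnorm_le_ReIm (((a +i* b)%C : Cplx R) - u n).
  by case: (u n).
- exact: cvg_cst.
- rewrite -[X in (_ --> X)%classic](addr0 0).
  have n0 (v : nat -> R) (c : R) : (v @ \oo --> c)%classic ->
      ((fun n => `|c - v n|) @ \oo --> (0 : R))%classic.
    move=> vc; rewrite -[X in (_ --> X)%classic](normr0 R) -(subrr c).
    apply: cvg_norm; apply: cvgB => //; exact: cvg_cst.
  by apply: cvgD; exact: n0.
Unshelve. all: by end_near.
Qed.

End ComplexNorm.

(** * Real series with bounded absolute partial sums *)

Section AbsoluteConvergence.
Variable R : realType.

Lemma nondecreasing_sum (t : nat -> R) : (forall m, 0 <= t m) ->
  {homo (fun N => \sum_(1 <= m < N) t m) : n m / (n <= m)%N >-> n <= m}.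
Proof.
move=> t0; apply/nondecreasing_seqP => -[|n].
  by rewrite !big_geq.
by rewrite [leRHS]big_nat_recr //= lerDl.
Qed.

(* [r + t >= 0] has bounded partial sums, so both [r + t] and [t] are
   summable. *)
Lemma dominated_sum_cvg (r t : nat -> R) (B : R) :
  (forall m, `|r m| <= t m) -> (forall N, \sum_(1 <= m < N) t m <= B) ->
  cvgn (fun N => \sum_(1 <= m < N) r m).
Proof.
move=> rt tB.
have t0 m : 0 <= t m by exact: le_trans (rt m).
have bnd (v : nat -> R) (D : R) : (forall m, 0 <= v m) ->
    (forall N, \sum_(1 <= m < N) v m <= D) ->
    cvgn (fun N => \sum_(1 <= m < N) v m).
  move=> v0 vD; apply: nondecreasing_is_cvgn; first exact: nondecreasing_sum.
  by exists D => _ [N _ <-].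
have ct := bnd _ _ t0 tB.
have crt : cvgn (fun N => \sum_(1 <= m < N) (r m + t m)).
  apply: (bnd _ (B + B)) => [m|N].
    by have := rt m; rewrite ler_norml => /andP[]; lra.
  rewrite big_split lerD//=.
  apply: le_trans (tB N); apply: ler_sum => m _.
  exact: le_trans (ler_norm _) (rt m).
rewrite [X in cvgn X](_ : _ = (fun N => \sum_(1 <= m < N) (r m + t m)) -
  (fun N => \sum_(1 <= m < N) t m)); first exact: is_cvgB.
apply/funext => N.
rewrite -[RHS]/(\sum_(1 <= m < N) (r m + t m) - \sum_(1 <= m < N) t m).
by rewrite big_split addrK.
Qed.

Lemma sum_inv_sqr_le2 (N : nat) : \sum_(1 <= n < N) (n%:R ^+ 2)^-1 <= 2 :> R.
Proof.
case: N => [|[|N]]; [by rewrite big_geq|by rewrite big_geq|].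
(* The bound is strengthened so that the induction closes: with [a = N + 1], the new term is at most
   [1 / (a (a + 1)) = 1 / a - 1 / (a + 1)], which telescopes. *)
apply: (@le_trans _ _ (2 - N.+1%:R^-1)); last by rewrite gerBl invr_ge0.
elim: N => [|N IH]; first by rewrite big_nat1 expr1n invr1; lra.
rewrite big_nat_recr //=.
apply: le_trans (lerD IH (lexx _)) _.
have h : 0 < N.+1%:R :> R by [].
rewrite -[N.+2]addn1 natrD.
set a : R := N.+1%:R in h *.
have a1 : 0 < a + 1 by rewrite addr_gt0.
have -> : a^-1 = (a + 1)^-1 + a^-1 * (a + 1)^-1 by field; rewrite !gt_eqF.
have : (a + 1)^-1 * (a + 1)^-1 <= a^-1 * (a + 1)^-1.
  by rewrite ler_pM2r ?invr_gt0// lef_pV2 ?posrE// lerDl.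
rewrite -exprVn expr2; move: ((a + 1)^-1) (a^-1) => u v.
move: (u * u) (v * u) => w z; lra.
Qed.

End AbsoluteConvergence.

Lemma cvgD_numField (K : numFieldType) (u v : nat -> K) (a b : K) :
  (u @ \oo --> a -> v @ \oo --> b ->
   (fun n => u n + v n) @ \oo --> a + b)%classic.
Proof. by move=> ua vb; apply: cvgD. Qed.

Lemma cvgZ_numField (K : numFieldType) (k : K) (u : nat -> K) (a : K) :
  (u @ \oo --> a -> (fun n => k * u n) @ \oo --> k * a)%classic.
Proof. by move=> ua; apply: cvgMl_tmp. Qed.

(** * Euler product of an absolutely convergent series supported on squarefree integers *)

Section SquarefreeEulerProduct.
Variables (R : realType) (b c : nat -> Cplx R) (K : R).
Hypothesis b1 : b 1%N = 1.
Hypothesis bM : forall p m, prime p -> (0 < m)%N -> ~~ (p %| m)%N ->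
  b (p * m)%N = c p * b m.
Hypothesis b_sqf : forall m, ~~ squarefree m -> b m = 0.
Hypothesis K_ge0 : 0 <= K.
Hypothesis cK : forall p, prime p -> cnorm (c p) <= K / p%:R ^+ 2.

Let primes_below (N : nat) : seq nat := [seq p <- index_iota 0 N | prime p].
Let squarefree_below (N : nat) : seq nat :=
  [seq m <- index_iota 1 N | squarefree m].

Let all_primes_below N : all prime (primes_below N).
Proof. exact: filter_all. Qed.

Let primes_below_uniq N : uniq (primes_below N).
Proof. by rewrite filter_uniq ?iota_uniq. Qed.

Let squarefree_below_uniq N : uniq (squarefree_below N).
Proof. by rewrite filter_uniq ?iota_uniq. Qed.

Let squarefree_below_sub N :
  {subset squarefree_below N <= subset_products (primes_below N)}.
Proof.
move=> m; rewrite mem_filter mem_index_iota => /and3P[sm m0 mN].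
rewrite mem_subset_products// m0 sm; apply/allP => p.
rewrite mem_primes inE => /and3P[pp _ pm].
by rewrite mem_filter pp mem_index_iota /= (leq_ltn_trans (dvdn_leq m0 pm)).
Qed.

Let sum_squarefree N :
  \sum_(1 <= m < N) b m = \sum_(m <- squarefree_below N) b m.
Proof.
rewrite big_filter [RHS]big_mkcond; apply: eq_bigr => m _.
by case: ifPn => // /b_sqf.
Qed.

(** Combines [1 + t <= exp t] with [\sum 1 / p^2 <= 2], the sum over primes being bounded by the sum
    over all integers. *)
Let prod_le_exp N :
  \prod_(p <- primes_below N) (1 + cnorm (c p)) <= expR (K * 2).
Proof.
apply: (@le_trans _ _ (expR (K * \sum_(p <- primes_below N) (p%:R ^+ 2)^-1))).
  rewrite mulr_sumr expR_sum; rewrite big_seq [leRHS]big_seq.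
  apply: ler_prod => p; rewrite mem_filter => /andP[pp _].
  rewrite addr_ge0 ?cnorm_ge0//=.
  by apply: le_trans (expR_ge1Dx _); rewrite lerD2l cK.
rewrite ler_expR ler_wpM2l//; apply: le_trans (sum_inv_sqr_le2 R N).
apply: ler_sum_uniq_sub => //; first exact: iota_uniq.
  move=> p; rewrite mem_filter !mem_index_iota => /andP[pp /andP[_ ->]].
  by rewrite prime_gt0.
Qed.

(** Every squarefree [m < N] has all its primes below [N], so these terms occur among the
    nonnegative terms of the expanded product of the [1 + cnorm (c p)]. *)
Let cnorm_sum_bound N : \sum_(1 <= m < N) cnorm (b m) <= expR (K * 2).
Proof.
have -> : \sum_(1 <= m < N) cnorm (b m) =
    \sum_(m <- squarefree_below N) cnorm (b m).
  rewrite big_filter [RHS]big_mkcond; apply: eq_bigr => m _.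
  by case: ifPn => // /b_sqf ->; rewrite cnorm0.
apply: le_trans (prod_le_exp N).
rewrite (@prod_sum_subset_products _ (fun m => cnorm (b m)))//.
- apply: ler_sum_uniq_sub => //.
  + exact: subset_products_uniq.
  + by move=> m; exact: cnorm_ge0.
- by rewrite b1 cnorm1.
- by move=> p m pp m0 pm; rewrite bM// cnormM.
Qed.

(** The expanded product contains every term [b m] with [m < N]; what is left over has indices
    [m >= N], so it is bounded by the tail of the absolute series. *)
Let dist_le_tail N (T : R) : (forall M, \sum_(1 <= m < M) cnorm (b m) <= T) ->
  cnorm (\prod_(p <- primes_below N) (1 + c p) - \sum_(1 <= m < N) b m)
  <= T - \sum_(1 <= m < N) cnorm (b m).
Proof.
move=> hT; have [->|N0] := posnP N.
  (* For [N = 0] the product is 1 and the sum is empty; [T] bounds the single term [b 1 = 1]. *)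
  rewrite !big_geq// !subr0 big_nil cnorm1 -cnorm1 -b1.
  by have := hT 2%N; rewrite big_nat1.
have uL := subset_products_uniq (all_primes_below N) (primes_below_uniq N).
set L := subset_products (primes_below N) in uL *.
rewrite (prod_sum_subset_products b1 bM) // sum_squarefree.
rewrite (big_uniq_sub b (squarefree_below_uniq N) uL (@squarefree_below_sub N)).
rewrite addrAC subrr add0r; apply: le_trans (cnorm_sum_le _ _ _) _.
(* [M] exceeds [N] and every index in the expansion, so the leftover terms all lie in [[N, M)]. *)
rewrite lerBrDl; set M := (N + \max_(m <- L) m).+1.
have NM : (N <= M)%N by rewrite /M; lia.
apply: le_trans (hT M); rewrite (big_cat_nat _ NM)//= lerD2l -big_filter.
apply: ler_sum_uniq_sub; rewrite ?filter_uniq ?iota_uniq//; last first.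
  by move=> m; exact: cnorm_ge0.
move=> m; rewrite mem_filter => /andP[mN mL].
have mM : (m < M)%N.
  have : (m <= \max_(k <- L) k)%N by exact: (@leq_bigmax_seq _ _ xpredT id).
  by rewrite /M; lia.
rewrite mem_index_iota mM andbT; move: mN mL.
rewrite mem_subset_products// mem_filter mem_index_iota negb_and.
move=> h /and3P[m0 sm _]; move: h; rewrite sm m0 /=; lia.
Qed.

Lemma squarefree_euler_product : exists A : Cplx R,
  ((fun N => \sum_(1 <= m < N) b m) @ \oo --> A /\
   (fun N => \prod_(0 <= p < N | prime p) (1 + c p)) @ \oo --> A)%classic.
Proof.
have cRe : cvgn (fun N => \sum_(1 <= m < N) complex.Re (b m)).
  exact: dominated_sum_cvg (fun m => Re_le_cnorm (b m)) cnorm_sum_bound.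
have cIm : cvgn (fun N => \sum_(1 <= m < N) complex.Im (b m)).
  exact: dominated_sum_cvg (fun m => Im_le_cnorm (b m)) cnorm_sum_bound.
have cT : cvgn (fun N => \sum_(1 <= m < N) cnorm (b m)).
  apply: dominated_sum_cvg cnorm_sum_bound => m.
  by rewrite ger0_norm ?cnorm_ge0.
have cA : ((fun N => \sum_(1 <= m < N) b m) @ \oo -->
  ((limn (fun N => \sum_(1 <= m < N) complex.Re (b m)) +i*
    limn (fun N => \sum_(1 <= m < N) complex.Im (b m)))%C : Cplx R))%classic.
  apply: cvg_ReIm.
  - by under eq_fun do rewrite raddf_sum.
  - by under eq_fun do rewrite raddf_sum.
eexists; split; first exact: cA.
(* The product is written as its difference from the partial sum plus the partial sum; the
   difference is squeezed to 0 by the tail. *)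
rewrite -[X in (_ --> X)%classic]add0r.
rewrite [X in (X @ _)%classic](_ : _ = fun N =>
  (\prod_(0 <= p < N | prime p) (1 + c p) - \sum_(1 <= m < N) b m)
  + \sum_(1 <= m < N) b m); last by apply/funext => N; rewrite subrK.
apply: (@cvgD_numField (Cplx R) _ _ _ _ _ cA); apply/cvg_cnormP.
set T := limn (fun N => \sum_(1 <= m < N) cnorm (b m)).
apply: (squeeze_cvgr (f := fun=> 0)
  (h := fun N => T - \sum_(1 <= m < N) cnorm (b m))).
- near=> N; rewrite cnorm_ge0 /= sub0r cnormN -big_filter.
  apply: dist_le_tail => M; apply: nondecreasing_cvgn_le cT M.
  by apply: nondecreasing_sum => m; exact: cnorm_ge0.
- exact: cvg_cst.
- rewrite -[X in (_ --> X)%classic](subrr T); exact: cvgB (cvg_cst _) cT.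
Unshelve. all: by end_near.
Qed.

End SquarefreeEulerProduct.

(** * Möbius function, sums over multiples and integer parts *)

Lemma moebius1 : moebius 1 = 1.
Proof. by []. Qed.

Lemma moebius_nsquarefree (m : nat) : ~~ squarefree m -> moebius m = 0.
Proof. by rewrite /moebius negbK => ->. Qed.

Lemma moebius_mul_prime (p m : nat) :
  prime p -> (0 < m)%N -> ~~ (p %| m)%N -> moebius (p * m) = - moebius m.
Proof.
move=> pp m0 pm; have := squarefree_mul_prime pp m0 pm.
rewrite /moebius /squarefree => /negb_inj ->.
rewrite (perm_size (perm_primes_mul_prime pp m0 pm)) /=.
by case: has; rewrite ?oppr0// exprS mulN1r.
Qed.

(** The quotients run through [1, ..., X %/ m], giving a triangular number. In the induction both
    sides change only when [m] divides [X + 1]. *)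
Lemma sum_multiples (A : comNzRingType) (m X : nat) : (0 < m)%N ->
  2 * \sum_(1 <= n < X.+1 | (m %| n)%N) (n %/ m)%:R =
  (X %/ m)%:R * ((X %/ m)%:R + 1) :> A.
Proof.
move=> m0; elim: X => [|X IH].
  by rewrite big_geq// div0n mul0r mulr0.
rewrite big_mkcond big_nat_recr //= -big_mkcond mulrDr IH divnS//.
case: (m %| X.+1)%N; rewrite ?mulr0 ?addr0//.
by rewrite add1n -[(X %/ m).+1%:R]natr1; ring.
Qed.

Lemma floor_div_nat (R : realType) (x : R) (m : nat) : 0 <= x -> (0 < m)%N ->
  Num.floor (x / m%:R) = (Num.truncn x %/ m)%N%:Z.
Proof.
move=> x0 m0; apply: floor_def.
have m0' : 0 < m%:R :> R by rewrite ltr0n.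
have /andP[h1 h2] := truncn_itv x0.
rewrite ler_pdivlMr// ltr_pdivrMr//; apply/andP; split.
  apply: le_trans h1; rewrite -[_%:~R]/((_ : nat)%:R) -natrM ler_nat.
  exact: leq_divM.
apply: lt_le_trans h2 _.
rewrite -PoszD -[_%:~R]/((_ : nat)%:R) -natrM ler_nat addn1.
exact: ltn_ceil.
Qed.

(** * Local factors at 1, the bound on gamma, and the divisor sum for the totient *)

Section LocalFactors.
Variables (R : realType) (d : nat) (F : polyEulerProduct R d).

Lemma cpowN1 (p : nat) : (0 < p)%N -> cpow p (- 1 : Cplx R) = p%:R^-1.
Proof.
move=> p0; rewrite /cpow /=.
rewrite oppr0 mul0r cos0 sin0 mulr1 mulr0 powR_inv1 ?ler0n//.
by rewrite -[p%:R in RHS](rmorph_nat (real_complex R)) -fmorphV.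
Qed.

Lemma local_factorV (p : nat) : (0 < p)%N ->
  (local_factor F p 1)^-1 = \prod_(j < d) (1 - ep_root F p j / p%:R).
Proof.
move=> p0; rewrite /local_factor /euler_factor -prodfV.
by apply: eq_bigr => j _; rewrite invrK cpowN1.
Qed.

Lemma gammaF_div (p : nat) : (0 < p)%N ->
  1 - gammaF F p / p%:R = (local_factor F p 1)^-1.
Proof.
move=> p0; rewrite /gammaF div1r; move: (_^-1) => z.
by field; rewrite pnatr_eq0 -lt0n.
Qed.

(* [(1 + y)^k - 1 <= (2^k - 1) y] for [0 <= y <= 1], in multilinear form. *)
Lemma cnorm_prod1B_le (I : Type) (r : seq I) (z : I -> Cplx R) (y : R) :
  0 <= y <= 1 -> (forall i, cnorm (z i) <= y) ->
  cnorm (1 - \prod_(i <- r) (1 - z i)) <= (2 ^+ size r - 1) * y.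
Proof.
move=> /andP[y0 y1] zy; elim: r => [|i r IH].
  by rewrite big_nil subrr cnorm0 expr0 subrr mul0r.
rewrite big_cons /=; set P := \prod_(j <- r) _ in IH *.
have -> : 1 - (1 - z i) * P = (1 - P) + (z i - z i * (1 - P)) by ring.
apply: le_trans (cnormD_le _ _) _.
have h : cnorm (z i - z i * (1 - P)) <= y + y * ((2 ^+ size r - 1) * y).
  apply: le_trans (cnormD_le _ _) _; rewrite cnormN cnormM.
  by apply: lerD => //; apply: ler_pM; rewrite ?cnorm_ge0.
apply: le_trans (lerD IH h) _; rewrite exprS.
have : 1 <= 2 ^+ size r :> R by rewrite exprn_ege1// ler1n.
move: (2 ^+ size r) => Q; rewrite -subr_ge0 => Q1.
have y1' : 0 <= 1 - y by rewrite subr_ge0.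
by have := mulr_ge0 (mulr_ge0 Q1 y0) y1'; lra.
Qed.

(** Each [ep_root F p j / p] has modulus at most [1 / p], so [1 - 1 / F_p(1)] is at most
    [(2^d - 1) / p], and the factor [p] in gamma cancels the denominator. *)
Lemma cnorm_gammaF_le (p : nat) : prime p -> cnorm (gammaF F p) <= 2 ^+ d.
Proof.
move=> pp; have p0 := prime_gt0 pp.
have p0' : 0 < p%:R :> R by rewrite ltr0n.
rewrite /gammaF div1r local_factorV// cnormM cnorm_nat.
apply: (@le_trans _ _ (p%:R * ((2 ^+ d - 1) * p%:R^-1))).
  rewrite ler_pM2l//.
  have := @cnorm_prod1B_le _ (index_enum 'I_d)
    (fun j => ep_root F p j / p%:R) p%:R^-1.
  rewrite [size _](_ : _ = d); last first.
    by rewrite -[RHS]card_ord cardE enumT.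
  apply; first by rewrite invr_ge0 ler0n /= invf_le1// ler1n.
  move=> j; rewrite cnormM cnormV cnorm_nat ler_piMl ?invr_ge0 ?ler0n//.
  by have := ep_root_le1 F j pp; rewrite cnormE -[1]/(RtoC 1) lecR.
by rewrite mulrCA mulfV ?gt_eqF// mulr1 gerBl.
Qed.

Lemma alphaF1 : alphaF F 1 = 1.
Proof. by rewrite /alphaF moebius1 /= big_nil mulr1. Qed.

Lemma alphaF_nsquarefree (m : nat) : ~~ squarefree m -> alphaF F m = 0.
Proof. by move=> /moebius_nsquarefree h; rewrite /alphaF h mul0r. Qed.

Lemma alphaF_mul_prime (p m : nat) :
  prime p -> (0 < m)%N -> ~~ (p %| m)%N ->
  alphaF F (p * m) = - gammaF F p * alphaF F m.
Proof.
move=> pp m0 pm; rewrite /alphaF moebius_mul_prime//.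
rewrite (perm_big _ (perm_primes_mul_prime pp m0 pm)) big_cons /=.
by rewrite rmorphN /=; ring.
Qed.

(** Expands the product over [p | n] of [1 - gamma(p) / p]. The upper limit [N] is free so that all
    [n] can share one range when sums are exchanged. *)
Lemma totientF_sum (n N : nat) : (0 < n < N)%N ->
  totientF F n =
  \sum_(1 <= m < N | (m %| n)%N) alphaF F m * (n %/ m)%:R.
Proof.
case/andP => n0 nN; rewrite /totientF.
have ps : all prime (primes n).
  by apply/allP => p; rewrite mem_primes => /and3P[].
have -> : \prod_(p <- primes n) (local_factor F p 1)^-1 =
    \prod_(p <- primes n) (1 + (- gammaF F p / p%:R)).
  rewrite big_seq [RHS]big_seq; apply: eq_bigr => p /(allP ps) pp.
  by rewrite -gammaF_div ?prime_gt0// mulNr.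
rewrite (@prod_sum_subset_products _ (fun m => alphaF F m / m%:R)) //;
  first last.
- exact: primes_uniq.
- move=> p m pp m0 pm; rewrite alphaF_mul_prime// natrM invfM.
  by rewrite mulrACA.
- by rewrite alphaF1 divr1.
rewrite (perm_big _ (subset_products_primes n0)) big_filter mulr_sumr.
(* Indices beyond [n] contribute nothing, since they cannot divide [n]. *)
rewrite [RHS](big_cat_nat _ (n := n.+1)) //= [X in _ + X]big_nat_cond.
rewrite [X in _ + X]big1 ?addr0; last first.
  by move=> m /andP[/andP[nm _] /(dvdn_leq n0)]; lia.
rewrite big_mkcond [RHS]big_mkcond big_nat [RHS]big_nat.
apply: eq_bigr => m /andP[m0 _].
have [mn|] := boolP (m %| n)%N; last by rewrite andbF.
have m0' : m%:R != 0 :> Cplx R by rewrite pnatr_eq0 -lt0n.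
have [sm|/alphaF_nsquarefree ->] := boolP (squarefree m); last first.
  by rewrite /= mul0r.
rewrite /= -{1}(divnK mn) natrM; by field.
Qed.

Lemma sum_totientF (X N : nat) : (X < N)%N ->
  2 * \sum_(1 <= n < X.+1) totientF F n =
  \sum_(1 <= m < N) alphaF F m * ((X %/ m)%:R * ((X %/ m)%:R + 1)).
Proof.
move=> XN.
have -> : \sum_(1 <= n < X.+1) totientF F n = \sum_(1 <= n < X.+1)
    \sum_(1 <= m < N | (m %| n)%N) alphaF F m * (n %/ m)%:R.
  by apply: eq_big_nat => n /andP[n0 nX]; apply: totientF_sum; lia.
rewrite (exchange_big_dep_nat xpredT)//= mulr_sumr.
apply: eq_big_nat => m /andP[m0 _].
by rewrite -mulr_sumr mulrCA sum_multiples.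
Qed.

End LocalFactors.

(** * Convergence of the series attached to alpha *)

Section Series.
Variables (R : realType) (d : nat) (F : polyEulerProduct R d).

Lemma alphaF_series : exists A : Cplx R,
  ((fun N => \sum_(1 <= m < N) alphaF F m / m%:R ^+ 2) @ \oo --> A /\
   (fun N => \prod_(0 <= p < N | prime p) (1 - gammaF F p / p%:R ^+ 2))
     @ \oo --> A)%classic.
Proof.
have [| | | | |A [h1 h2]] := @squarefree_euler_product R
  (fun m => alphaF F m / m%:R ^+ 2) (fun p => - gammaF F p / p%:R ^+ 2)
  (2 ^+ d).
- by rewrite alphaF1 expr1n divr1.
- move=> p m pp m0 pm; rewrite alphaF_mul_prime// natrM exprMn invfM.
  by rewrite mulrACA.
- by move=> m /alphaF_nsquarefree ->; rewrite mul0r.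
- by rewrite exprn_ge0.
- move=> p pp; rewrite cnormM cnormN cnormV.
  have -> : cnorm (p%:R ^+ 2 : Cplx R) = p%:R ^+ 2.
    by rewrite cnormM cnorm_nat.
  by rewrite ler_wpM2r ?invr_ge0 ?sqr_ge0// cnorm_gammaF_le.
exists A; split; first exact: h1.
by under eq_fun do under eq_bigr do rewrite -mulNr.
Qed.

Lemma frac_part_small (x : R) (m : nat) : 0 <= x -> (Num.truncn x < m)%N ->
  Num.floor (x / m%:R) = 0 /\ frac_part (x / m%:R) = x / m%:R.
Proof.
move=> x0 xm; have m0 : (0 < m)%N by exact: leq_ltn_trans xm.
have h : Num.floor (x / m%:R) = 0 by rewrite floor_div_nat// divn_small.
by rewrite /frac_part h subr0.
Qed.

Lemma RtoC_div_nat (x : R) (m : nat) : RtoC (x / m%:R) = RtoC x / m%:R.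
Proof.
rewrite -[m%:R in RHS](rmorph_nat (real_complex R)).
by rewrite /RtoC -fmorphV -rmorphM.
Qed.

(** Past [X] the partial sums of [u] are [k] times those of [v] plus a fixed correction from the
    first [X] terms. It serves the series of [f] with [k = x] and that of [g] with [k = x^2]. *)
Lemma cvg_eventually_scaled (u v : nat -> Cplx R) (k A : Cplx R) (X : nat) :
  (forall m, (X < m)%N -> u m = k * v m) ->
  ((fun N => \sum_(1 <= m < N) v m) @ \oo --> A)%classic ->
  cvgn (fun N => \sum_(1 <= m < N) u m).
Proof.
move=> uv vA.
apply/cvg_ex; exists
  ((\sum_(1 <= m < X.+1) u m - k * \sum_(1 <= m < X.+1) v m) + k * A).
have e : ((fun N => (\sum_(1 <= m < X.+1) u m - k * \sum_(1 <= m < X.+1) v m)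
      + k * \sum_(1 <= m < N) v m) @ \oo -->
  (\sum_(1 <= m < X.+1) u m - k * \sum_(1 <= m < X.+1) v m) + k * A)%classic.
  apply: cvgD_numField; first exact: cvg_cst.
  exact: cvgZ_numField.
apply: cvg_trans e; apply: near_eq_cvg; near=> N.
have XN : (X.+1 <= N)%N by near: N; exact: nbhs_infty_ge.
rewrite [\sum_(1 <= m < N) v m](big_cat_nat _ (n := X.+1))//=.
rewrite [RHS](big_cat_nat _ (n := X.+1))//=.
have -> : \sum_(X.+1 <= m < N) u m = k * \sum_(X.+1 <= m < N) v m.
  by rewrite mulr_sumr; apply: eq_big_nat => m /andP[Xm _]; exact: uv.
ring.
Unshelve. all: by end_near.
Qed.

Lemma RtoC_frac_part (x : R) (m : nat) : 0 <= x -> (0 < m)%N ->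
  RtoC (frac_part (x / m%:R)) = RtoC x / m%:R - (Num.truncn x %/ m)%:R.
Proof.
move=> x0 m0; rewrite /frac_part floor_div_nat// -RtoC_div_nat.
by rewrite /RtoC rmorphB /= -[_%:~R]/((_ : nat)%:R) rmorph_nat.
Qed.

End Series.

(** * Termwise identity and passage to the limit *)

Theorem theorem2p1p3 (R : realType) (d : nat) (F : polyEulerProduct R d)
    (x : R) (hx : 1 <= x) :
  errorF F x = RtoC x * f_F F x + 1 / 2 * g_F F x.
Proof.
have x0 : 0 <= x by exact: le_trans hx.
have hausC : hausdorff_space (Cplx R) by exact: norm_hausdorff.
have [A [cA cP]] := alphaF_series F.
set X := Num.truncn x.
set fterm := fun m => alphaF F m / m%:R * RtoC (frac_part (x / m%:R)).
set gterm := fun m => alphaF F m * (RtoC (frac_part (x / m%:R)) ^+ 2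
  + (Num.floor (x / m%:R))%:~R).
have cf : cvgn (fun N => \sum_(1 <= m < N) fterm m).
  apply: (cvg_eventually_scaled (k := RtoC x) (X := X) _ cA) => m Xm.
  rewrite /fterm (frac_part_small x0 Xm).2 RtoC_div_nat expr2 invfM.
  by rewrite mulrACA [RHS]mulrA [RtoC x * _]mulrC.
have cg : cvgn (fun N => \sum_(1 <= m < N) gterm m).
  apply: (cvg_eventually_scaled (k := RtoC x ^+ 2) (X := X) _ cA) => m Xm.
  have [h1 h2] := frac_part_small x0 Xm.
  rewrite /gterm h1 h2 RtoC_div_nat addr0 exprMn exprVn.
  by rewrite mulrCA.
set Lf := limn (fun N => \sum_(1 <= m < N) fterm m) in cf.
set Lg := limn (fun N => \sum_(1 <= m < N) gterm m) in cg.
(* [A] is both the Euler product in [C(F)] and the sum of [alpha(m) / m^2]; this is where the main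
   term [C(F) x^2] gets identified. *)
have eC : constF F = 1 / 2 * A by rewrite /constF (cvg_lim hausC cP).
have ef : f_F F x = - Lf by [].
have eg : g_F F x = Lg by [].
rewrite /errorF eC ef eg.
set Phi := \sum_(1 <= n < X.+1) totientF F n.
suff key : 2 * Phi = RtoC x ^+ 2 * A + (- (2 * RtoC x) * Lf + Lg).
  have -> : Phi = 2^-1 * (2 * Phi) by rewrite mulKf.
  by rewrite key; field.
have lim1 : ((fun N => RtoC x ^+ 2 * (\sum_(1 <= m < N) alphaF F m / m%:R ^+ 2)
    + (- (2 * RtoC x) * (\sum_(1 <= m < N) fterm m)
       + \sum_(1 <= m < N) gterm m)) @ \oo -->
    RtoC x ^+ 2 * A + (- (2 * RtoC x) * Lf + Lg))%classic.
  have hA := cvgZ_numField (k := RtoC x ^+ 2) cA.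
  have hf := cvgZ_numField (k := - (2 * RtoC x)) cf.
  exact: (cvgD_numField hA (cvgD_numField hf cg)).
(* The combined partial sums equal the constant [2 * Phi] as soon as [N > X], so their limit is also
   [2 * Phi]. *)
apply: (cvg_unique hausC _ lim1).
have lim2 : ((fun _ : nat => 2 * Phi) @ \oo --> 2 * Phi)%classic.
  exact: cvg_cst.
apply: cvg_trans lim2; apply: near_eq_cvg; near=> N.
have XN : (X < N)%N by near: N; exact: nbhs_infty_ge.
rewrite (sum_totientF F XN) !mulr_sumr -!big_split /=.
(* With [y = x / m] and [q = X %/ m], both the integer part of [y] and [y - {y}] are [q], which
   leaves a polynomial identity in [y] and [q]. *)
apply: eq_big_nat => m /andP[m0 _].
have m0' : m%:R != 0 :> Cplx R by rewrite pnatr_eq0 -lt0n.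
rewrite /fterm /gterm RtoC_frac_part// floor_div_nat//.
rewrite -[(Posz _)%:~R]/((_ : nat)%:R) -/X.
by field.
Unshelve. all: by end_near.
Qed.
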